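(* Let $G$ be a Lie group and let $M$ be a $G$-manifold with proper $G$-action admitting a slice at every point. Assume that the approximation property $M_{\geq(H)}\subseteq\overline{M_{(H)}}$ holds for every stabilizer subgroup $H\subseteq G$. Then the partition of $M$ into the orbit type submanifolds $M_{(H)}$ is a stratification.
   Context: Manifolds are smooth Hausdorff manifolds modelled on locally convex spaces (smoothness in the Michal--Bastiani sense; the model space may vary from chart to chart, and different connected components may have non-isomorphic model spaces), and Lie groups are groups in this category. A submanifold is a subset that in suitable charts of the ambient manifold corresponds to a closed linear subspace of the model space (not necessarily complemented). A $G$-manifold is a manifold $M$ with a smooth left action $(g,m)\mapsto g\cdot m$; $G_m$ is the stabilizer of $m$. The action is proper if $G\times M\to M\times M$, $(g,m)\mapsto(g\cdot m,m)$ is proper (preimages of compact sets are compact). A Lie subgroup $H\subseteq G$ is principal if $G\to G/H$ is a (smooth, locally trivial) principal $H$-bundle. $(H)$ denotes the conjugacy class of $H$ in $G$; $(G_m)$ is the orbit type of $m$. One writes $(H)\le(K)$ if $aHa^{-1}\subseteq K$ for some $a\in G$. Put $M_{(H)}=\{m\in M:(G_m)=(H)\}$ and $M_{\ge(H)}=\{m\in M:(H)\le(G_m)\}$. A slice at $m\in M$ is a submanifold $S\subseteq M$ containing $m$ such that: (SL1) $G_m\cdot S\subseteq S$. (SL2) Any $g\in G$ with $(g\cdot S)\cap S\neq\emptyset$ lies in $G_m$. (SL3) $G_m$ is a principal Lie subgroup of $G$ and $G\to G/G_m$ admits a smooth local section $\chi: G/G_m\supseteq U\to G$ on an open neighborhood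 $U$ of the identity coset $[e]$ such that $U\times S\to M$, $([g],s)\mapsto\chi([g])\cdot s$ is a diffeomorphism onto an open neighborhood of $m$ in $M$. (SL4) $S_{(G_m)}=\{s\in S: G_s\text{ is conjugate to }G_m\}$ is a closed submanifold of $S$. A partition of a Hausdorff space $X$ into subsets $X_\sigma$, $\sigma\in\Sigma$, is a stratification if: (DS1) every $X_\sigma$ is a locally closed manifold (whose manifold topology coincides with the relative topology); (DS2) every pair of disjoint pieces $X_\varsigma,X_\sigma$ with $X_\varsigma\cap\overline{X_\sigma}\neq\emptyset$ satisfies: (a) $X_\varsigma\subseteq\overline{X_\sigma}\setminus X_\sigma$, and (b) $X_\sigma\cap\overline{X_\varsigma}=\emptyset$. *)

(* Defs.v *)
From HB Require Import structures.
From mathcomp Require Import all_boot all_order all_algebra.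
From mathcomp Require Import all_classical reals topology tvs.

Set Implicit Arguments.
Unset Strict Implicit.
Unset Printing Implicit Defensive.

Import GRing.Theory numFieldTopology.Exports.

Local Open Scope classical_set_scope.
Local Open Scope ring_scope.

(* Calculus on locally convex spaces (Michal--Bastiani). *)

(* [MB_class n U f]: the restriction of [f] to the open set [U] is of class
   C^n, i.e. it is continuous, all directional derivatives exist, and
   df : U x E -> F is of class C^(n-1). The values of [f] outside [U] are
   irrelevant. *)
Fixpoint MB_class (R : realType) (n : nat) (E F : tvsType R) (U : set E)
    (f : E -> F) : Prop :=
  (forall x, U x -> {for x, continuous f}) /\
  if n is n'.+1 then
    exists df : E * E -> F,
      (forall x v, U x ->
         (fun h : R => h^-1 *: (f (x + h *: v) - f x)) @ (0 : R)^' -->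
           df (x, v)) /\
      MB_class n' (U `*` setT) df
  else True.

Definition MB_smooth (R : realType) (E F : tvsType R) (U : set E)
  (f : E -> F) : Prop := forall n, MB_class n U f.

(* Manifolds. *)

(* A chart is a homeomorphism from the open set [chart_dom] onto an open subset
   of a Hausdorff locally convex space [E]; both directions are represented by
   total functions with junk values outside the relevant open sets. *)
Record chart (R : realType) (T : topologicalType) (E : tvsType R) := Chart {
  chart_dom : set T;
  chart_map :> T -> E;
  chart_inv : E -> T;
  chart_model_hausdorff : hausdorff_space E;
  chart_dom_open : open chart_dom;
  chart_img_open : open (chart_map @` chart_dom);
  chart_mapK : forall x, chart_dom x -> chart_inv (chart_map x) = x;
  chart_map_continuous :
    forall x, chart_dom x -> {for x, continuous chart_map};
  chart_inv_continuous :
    forall y, (chart_map @` chart_dom) y -> {for y, continuous chart_inv}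
}.

(* The model space may vary from chart to chart. Atlases are not required to be
   maximal; [admissible] describes the charts of the maximal atlas. *)
Definition atlas (R : realType) (T : topologicalType) :=
  forall E : tvsType R, set (chart T E).

Definition compatible (R : realType) (T : topologicalType) (E F : tvsType R)
    (c : chart T E) (d : chart T F) : Prop :=
  MB_smooth (c @` (chart_dom c `&` chart_dom d)) (d \o chart_inv c) /\
  MB_smooth (d @` (chart_dom c `&` chart_dom d)) (c \o chart_inv d).

Definition is_manifold (R : realType) (T : topologicalType)
    (A : atlas R T) : Prop :=
  [/\ hausdorff_space T,
      forall x : T, exists (E : tvsType R) (c : chart T E),
        A E c /\ chart_dom c x
    & forall (E F : tvsType R) (c : chart T E) (d : chart T F),
        A E c -> A F d -> compatible c d].

Definition admissible (R : realType) (T : topologicalType) (A : atlas R T)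
    (E : tvsType R) (c : chart T E) : Prop :=
  forall (F : tvsType R) (d : chart T F), A F d -> compatible c d.

Lemma open_setX (T T' : topologicalType) (A : set T) (B : set T') :
  open A -> open B -> open (A `*` B).
Proof.
rewrite !openE => oA oB [x y] [/= Ax By].
by exists (A, B) => //; split; [exact: oA|exact: oB].
Qed.

Section ProductChart.
Context (R : realType) (T T' : topologicalType) (E E' : tvsType R).
Context (c : chart T E) (c' : chart T' E').

Let dom := chart_dom c `*` chart_dom c'.
Let fwd (p : T * T') := (c p.1, c' p.2).
Let bwd (q : E * E') := (chart_inv c q.1, chart_inv c' q.2).

Let hausdorff_prod : hausdorff_space (E * E')%type.
Proof.
have hE := chart_model_hausdorff c; have hE' := chart_model_hausdorff c'.
move=> [x x'] [y y'] cl; congr pair.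
  apply: hE => A B xA yB.
  have [] := cl (A `*` setT) (B `*` setT).
  - by exists (A, setT) => //; split => //; exact: filterT.
  - by exists (B, setT) => //; split => //; exact: filterT.
  by move=> [z z'] [[/= Az _] [/= Bz _]]; exists z.
apply: hE' => A B xA yB.
have [] := cl (setT `*` A) (setT `*` B).
- by exists (setT, A) => //; split => //; exact: filterT.
- by exists (setT, B) => //; split => //; exact: filterT.
by move=> [z z'] [[/= _ Az] [/= _ Bz]]; exists z'.
Qed.

Let img_prod :
  fwd @` dom = (c @` chart_dom c) `*` (c' @` chart_dom c').
Proof.
apply/seteqP; split=> [_ [[x x'] [/= dx dx'] <-]|[y y']].
  by split; [exists x|exists x'].
by move=> [[x dx /= <-] [x' dx' /= <-]]; exists (x, x').
Qed.

Let img_open : open (fwd @` dom).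
Proof. by rewrite img_prod; apply: open_setX; exact: chart_img_open. Qed.

Let fwdK x : dom x -> bwd (fwd x) = x.
Proof. by case: x => x x' [/= dx dx']; rewrite /bwd /fwd /= !chart_mapK. Qed.

Let fwd_continuous x : dom x -> {for x, continuous fwd}.
Proof.
case: x => x x' [/= dx dx'].
apply: (@cvg_pair _ _ _ _ (nbhs (c x)) (nbhs (c' x'))) => /=.
  apply: (@cvg_comp _ _ _ fst c _ (nbhs x)); first exact: cvg_fst.
  exact: (chart_map_continuous dx).
apply: (@cvg_comp _ _ _ snd c' _ (nbhs x')); first exact: cvg_snd.
exact: (chart_map_continuous dx').
Qed.

Let bwd_continuous y : (fwd @` dom) y -> {for y, continuous bwd}.
Proof.
rewrite img_prod; case: y => y y' [/= dy dy'].
apply: (@cvg_pair _ _ _ _ (nbhs (chart_inv c y)) (nbhs (chart_inv c' y'))) => /=.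
  apply: (@cvg_comp _ _ _ fst (chart_inv c) _ (nbhs y)); first exact: cvg_fst.
  exact: (chart_inv_continuous dy).
apply: (@cvg_comp _ _ _ snd (chart_inv c') _ (nbhs y')); first exact: cvg_snd.
exact: (chart_inv_continuous dy').
Qed.

Definition prod_chart : chart (T * T')%type (E * E')%type :=
  Chart hausdorff_prod (open_setX (chart_dom_open c) (chart_dom_open c'))
    img_open fwdK fwd_continuous bwd_continuous.

End ProductChart.

Inductive prod_atlas (R : realType) (T T' : topologicalType)
    (A : atlas R T) (A' : atlas R T') : atlas R (T * T')%type :=
  ProdAtlas (E E' : tvsType R) (c : chart T E) (c' : chart T' E') :
    A E c -> A' E' c' -> prod_atlas A A' (prod_chart c c').

Definition smooth_on (R : realType) (T T' : topologicalType)
    (A : atlas R T) (A' : atlas R T') (D : set T) (f : T -> T') : Prop :=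
  (forall x, D x -> {for x, continuous f}) /\
  forall (E E' : tvsType R) (c : chart T E) (c' : chart T' E'),
    A E c -> A' E' c' ->
    MB_smooth (c @` (chart_dom c `&` D `&` f @^-1` chart_dom c'))
      (c' \o f \o chart_inv c).

(* [f] restricts to a diffeomorphism from the open set [D] onto an open set. *)
Definition open_diffeo_on (R : realType) (T T' : topologicalType)
    (A : atlas R T) (A' : atlas R T') (D : set T) (f : T -> T') : Prop :=
  [/\ open D, open (f @` D), smooth_on A A' D f
    & exists g : T' -> T,
        (forall x, D x -> g (f x) = x) /\ smooth_on A' A (f @` D) g].

(* Submanifolds. *)

Definition is_submanifold (R : realType) (T : topologicalType)
    (A : atlas R T) (S : set T) : Prop :=
  forall x, S x -> exists (E : tvsType R) (c : chart T E) (F : set E),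
    [/\ admissible A c, chart_dom c x, submod_closed [in F], closed F
      & c @` (chart_dom c `&` S) = c @` chart_dom c `&` F].

(* The induced structure on a submanifold [S], seen as a topological space
   [set_type S] with the relative topology: its charts are the restrictions of
   submanifold charts [c]. The closed linear subspace of [E] onto which [c] maps
   [S] is presented as the image of a locally convex space [F] under a linear
   closed embedding [i]. *)
Definition sub_atlas (R : realType) (T : topologicalType) (A : atlas R T)
    (S : set T) : atlas R S :=
  fun F => [set d | exists (E : tvsType R) (c : chart T E)
      (i : {linear F -> E}),
    [/\ admissible A c,
        [/\ continuous i, injective i
          & forall C, closed C -> closed (i @` C)],
        c @` (chart_dom c `&` S) = c @` chart_dom c `&` range i,
        chart_dom d = set_val @^-1` chart_dom c
      & forall s, chart_dom d s -> i (d s) = c (set_val s)]].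

(* Lie groups. *)

(* No compatibility between the topology and the group operations is built in;
   for Lie groups, continuity is part of smoothness. *)
#[short(type="preTopologicalGroupType")]
HB.structure Definition PreTopologicalGroup :=
  {G of Topological G & Group G}.

Local Open Scope group_scope.

Definition is_lie_group (R : realType) (G : preTopologicalGroupType)
    (AG : atlas R G) : Prop :=
  [/\ is_manifold AG,
      smooth_on (prod_atlas AG AG) AG setT (fun p : G * G => p.1 * p.2)
    & smooth_on AG AG setT (fun g : G => g^-1)].

Definition is_subgroup (G : groupType) (H : set G) : Prop :=
  [/\ H 1, forall g h, H g -> H h -> H (g * h) & forall g, H g -> H g^-1].

(* The group operations of a subgroup that is a submanifold are automatically
   smooth for [sub_atlas AG]. *)
Definition is_lie_subgroup (R : realType) (G : preTopologicalGroupType)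
    (AG : atlas R G) (H : set G) : Prop :=
  is_subgroup H /\ is_submanifold AG H.

(* G/H, the space of left cosets gH with the quotient topology. *)
Section CosetSpace.
Context (G : preTopologicalGroupType) (H : set G).

Definition left_coset (g : G) : set G := [set g * h | h in H].

Definition coset_rel : rel G :=
  fun g g' => `[< left_coset g = left_coset g' >].

Let coset_rel_refl : reflexive coset_rel.
Proof. by move=> g; apply/asboolP. Qed.

Let coset_rel_sym : symmetric coset_rel.
Proof. by move=> g g'; apply/asboolP/asboolP. Qed.

Let coset_rel_trans : transitive coset_rel.
Proof. by move=> g g' g'' /asboolP e /asboolP e'; apply/asboolP; rewrite e. Qed.

Canonical coset_equiv :=
  EquivRel coset_rel coset_rel_refl coset_rel_sym coset_rel_trans.

Definition coset_space : topologicalType :=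
  quotient_topology {eq_quot coset_equiv}%qT.

Definition coset_proj (g : G) : coset_space :=
  (\pi_({eq_quot coset_equiv}) g)%qT.

End CosetSpace.

(* G -> G/H is a smooth locally trivial principal H-bundle, where G/H carries
   the manifold structure [AQ] and H acts on G by right translations. The local
   trivialization over [V] is g |-> (gH, theta g). *)
Definition is_principal_bundle (R : realType) (G : preTopologicalGroupType)
    (AG : atlas R G) (H : set G) (AQ : atlas R (coset_space H)) : Prop :=
  [/\ is_manifold AQ,
      smooth_on AG AQ setT (@coset_proj G H)
    & forall q : coset_space H,
        exists (V : set (coset_space H)) (theta : G -> H),
        let D := @coset_proj G H @^-1` V in
        let triv := fun g => (coset_proj H g, theta g) in
        [/\ open V, V q,
            open_diffeo_on AG (prod_atlas AQ (sub_atlas AG (S := H))) D triv,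
            triv @` D = V `*` setT
          & forall g h, D g -> H h ->
              set_val (theta (g * h)) = set_val (theta g) * h]].

(* Actions and orbit types. *)

Definition is_action (G : groupType) (M : Type) (act : G -> M -> M) : Prop :=
  (forall m, act 1 m = m) /\
  (forall g h m, act (g * h) m = act g (act h m)).

Definition is_Gmanifold (R : realType) (G : preTopologicalGroupType)
    (M : topologicalType) (AG : atlas R G) (AM : atlas R M)
    (act : G -> M -> M) : Prop :=
  [/\ is_manifold AM, is_action act
    & smooth_on (prod_atlas AG AM) AM setT (fun p : G * M => act p.1 p.2)].

Definition is_proper_action (G : preTopologicalGroupType) (M : topologicalType)
    (act : G -> M -> M) : Prop :=
  forall K : set (M * M), compact K ->
    compact ((fun p : G * M => (act p.1 p.2, p.2)) @^-1` K).

Definition stabilizer (G M : Type) (act : G -> M -> M) (m : M) : set G :=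
  [set g | act g m = m].

Definition conjugate (G : groupType) (a : G) (H : set G) : set G :=
  [set a * h * a^-1 | h in H].

Definition conj_class (G : groupType) (H : set G) : set (set G) :=
  [set conjugate a H | a in setT].

Definition subconjugate (G : groupType) (H K : set G) : Prop :=
  exists a : G, conjugate a H `<=` K.

Definition orbit_type (G : groupType) (M : Type) (act : G -> M -> M) (m : M) :
  set (set G) := conj_class (stabilizer act m).

(* The set of points of orbit type [t]; for t = (H) this is M_(H). *)
Definition of_orbit_type (G : groupType) (M : Type) (act : G -> M -> M)
  (t : set (set G)) : set M := [set m | orbit_type act m = t].

Definition orbit_type_ge (G : groupType) (M : Type) (act : G -> M -> M)
  (H : set G) : set M := [set m | subconjugate H (stabilizer act m)].

(* Slices. *)

Definition is_slice (R : realType) (G : preTopologicalGroupType)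
    (M : topologicalType) (AG : atlas R G) (AM : atlas R M)
    (act : G -> M -> M) (m : M) (S : set M) : Prop :=
  let Gm := stabilizer act m in
  let AS := sub_atlas AM (S := S) in
  let S_Gm : set S :=
    [set s | conj_class Gm (stabilizer act (set_val s))] in
  (is_submanifold AM S /\ S m) /\
  [/\ (forall g s, Gm g -> S s -> S (act g s)),
      (forall g, act g @` S `&` S !=set0 -> Gm g),
      is_lie_subgroup AG Gm /\
      (exists AQ : atlas R (coset_space Gm),
        is_principal_bundle AG AQ /\
        exists (U : set (coset_space Gm)) (chi : coset_space Gm -> G),
          let Phi := fun p : coset_space Gm * S =>
            act (chi p.1) (set_val p.2) in
          [/\ open U /\ U (coset_proj Gm 1),
              smooth_on AQ AG U chi,
              forall q, U q -> coset_proj Gm (chi q) = q,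
              open_diffeo_on (prod_atlas AQ AS) AM (U `*` setT) Phi
            & (Phi @` (U `*` setT)) m])
    & closed S_Gm /\ is_submanifold AS S_Gm].

(* Stratifications. *)

Definition locally_closed (T : topologicalType) (A : set T) : Prop :=
  exists O C : set T, [/\ open O, closed C & A = O `&` C].

(* The manifold structures on the pieces are given on the types [set_type (X i)]
   and hence for the relative topology. *)
Definition is_stratification (R : realType) (T : topologicalType) (I : Type)
    (Sigma : set I) (X : I -> set T) (AX : forall i, atlas R (X i)) : Prop :=
  [/\ hausdorff_space T,
      partition Sigma X setT,
      forall i, Sigma i -> locally_closed (X i) /\ is_manifold (AX i)
    & forall i j, Sigma i -> Sigma j -> X i `&` X j = set0 ->
        X i `&` closure (X j) !=set0 ->
        X i `<=` closure (X j) `\` X j /\ X j `&` closure (X i) = set0].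

(* Main.v *)
Require Import Defs.
From HB Require Import structures.
From mathcomp Require Import all_boot all_order all_algebra.
From mathcomp Require Import interval_inference all_classical reals topology.
From mathcomp Require Import convex tvs.
From mathcomp Require Import ring lra.

(** The slice at [m] gives a tube, the image of [G/G_m x S] under a
    diffeomorphism onto a neighbourhood of [m]. In the tube the points of orbit
    type [(G_m)] form [G/G_m x S_(G_m)], so product charts show that every
    [M_(H)] is a submanifold ([orbit_type_submanifold_chart]). Being a
    submanifold, [M_(H)] is locally closed ([submanifold_locally_closed]) and is
    a manifold for the induced atlas ([sub_atlas_manifold]).

    For the frontier condition, suppose that [m] lies in [M_(K)] and in the
    closure of [M_(H)]. All stabilizers in the tube are subconjugate to [G_m]
    ([slice_subconjugate_nbhs]), and some point of [M_(H)] is in the tube, so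
    [(H) <= (K)]. Hence [M_(K)] is contained in [M_(>= (H))], which by the
    approximation property lies in the closure of [M_(H)]. That [M_(H)] does not
    meet the closure of [M_(K)] follows from local closedness: the frontier of
    [M_(H)] is closed and contains [M_(K)] ([frontier_condition]).

    The remaining work is calculus. Atlases are not maximal and submanifold
    charts are only admissible, so every change of charts has to be factored
    through charts of the atlas; this needs the chain rule for maps between
    locally convex spaces ([MB_class_comp]). It rests on a mean value theorem
    for curves whose derivative takes values in an open convex set
    ([mean_value]), which controls difference quotients in a variable direction
    ([dquot_uniform]). For induced atlases one needs moreover that a closed
    linear embedding reflects smoothness ([MB_class_embedding]), and that a
    closed linear subspace is itself a locally convex space
    ([lin_subspace_embedding]). *)

Set Implicit Arguments.
Unset Strict Implicit.
Unset Printing Implicit Defensive.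
Import Order.TTheory GRing.Theory Num.Theory numFieldTopology.Exports.
Local Open Scope classical_set_scope.
Local Open Scope ring_scope.

(** * A mean value theorem in locally convex spaces *)

Section MeanValue.
Context (R : realType) (F : tvsType R).

Definition convex_comb (D : set F) := forall y z (l : R),
  D y -> D z -> 0 <= l <= 1 -> D (l *: y + (1 - l) *: z).

Lemma convex_open_nbhs (x : F) (A : set F) : nbhs x A ->
  exists D : set F, [/\ open D, D x, D `<=` A & convex_comb D].
Proof.
have [B cB [oB bB]] := @locally_convex R F.
move=> /bB[D [BD Dx] DA]; exists D; split => //; first exact: oB.
move=> y z l Dy Dz /andP[l0 l1].
have := cB D (mem_set BD) y z (Itv01 l0 l1) (mem_set Dy) (mem_set Dz).
by rewrite inE.
Qed.

(** Additivity of increments together with convexity of [D] makes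
    [D ((t - s)^-1 *: (f t - f s))] an additive property of the interval
    [[s, t]]; differentiability makes it true on small intervals touching a
    given point. The supremum of the [t] such that [[a, t]] has the property
    must therefore be [b]. *)
Lemma mean_value (D : set F) (f df : R -> F) (a b : R) :
  a < b -> open D -> convex_comb D ->
  (forall t, a <= t <= b -> D (df t)) ->
  (forall t, a <= t <= b ->
     (fun h : R => h^-1 *: (f (t + h) - f t)) @ (0 : R)^' --> df t) ->
  D ((b - a)^-1 *: (f b - f a)).
Proof.
move=> ab oD cD Ddf fdf.
pose P (s t : R) := s < t -> D ((t - s)^-1 *: (f t - f s)).
have Pxx (s : R) : P s s by rewrite /P ltxx.
have Padd (r s t : R) : r <= s -> s <= t -> P r s -> P s t -> P r t.
  rewrite le_eqVlt => /predU1P[-> _ _ //|rs].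
  rewrite le_eqVlt => /predU1P[<- //|st] /(_ rs) Prs /(_ st) Pst rt.
  have rs0 : s - r != 0 by rewrite subr_eq0 gt_eqF.
  have st0 : t - s != 0 by rewrite subr_eq0 gt_eqF.
  have rt0 : t - r != 0 by rewrite subr_eq0 gt_eqF.
  have l01 : 0 <= (s - r) / (t - r) <= 1.
    rewrite divr_ge0 ?subr_ge0 ?(ltW rs) ?(ltW rt) //=.
    by rewrite ler_pdivrMr ?subr_gt0 // mul1r lerB // ltW.
  have := cD _ _ _ Pst Prs; move/(_ ((t - s) / (t - r))).
  have -> : 1 - (t - s) / (t - r) = (s - r) / (t - r) by field.
  have -> : (t - s) / (t - r) *: ((t - s)^-1 *: (f t - f s)) +
      (s - r) / (t - r) *: ((s - r)^-1 *: (f s - f r)) =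
      (t - r)^-1 *: (f t - f r).
    rewrite !scalerA mulrAC divff // mul1r mulrAC divff // mul1r -scalerDr.
    by rewrite addrA addrNK.
  apply; rewrite divr_ge0 ?subr_ge0 ?(ltW st) ?(ltW rt) //=.
  by rewrite ler_pdivrMr ?subr_gt0 // mul1r lerB // ltW.
(* Two one-sided statements, since only intervals with endpoint [t] are
   controlled by the derivative at [t]. *)
have Ploc (t : R) : a <= t <= b ->
    exists2 e : R, 0 < e & forall h : R, 0 < h -> h < e -> P (t - h) t /\ P t (t + h).
  move=> tab; have := fdf t tab D (open_nbhs_nbhs (conj oD (Ddf t tab))).
  move=> [e /= e0 eD]; exists e => // h h0 he.
  have he' : ball (0 : R) e h by rewrite /ball /= sub0r normrN gtr0_norm.
  have hNe : ball (0 : R) e (- h) by rewrite /ball /= sub0r normrN normrN gtr0_norm.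
  split => _.
    have := eD (- h) hNe; rewrite oppr_eq0 gt_eqF // => /(_ isT) /=.
    by rewrite subKr invrN scaleNr -scalerN opprB.
  have := eD h he'; rewrite gt_eqF // => /(_ isT) /=.
  by rewrite addrAC subrr add0r.
pose A := [set t | a <= t <= b /\ P a t].
have Aa : A a by split; [rewrite lexx ltW|exact: Pxx].
have ubA : ubound A b by move=> t [/andP[]].
have supA : has_sup A by split; [exists a|exists b].
have sb : sup A <= b by apply: ge_sup => //; exists a.
have as_ : a <= sup A by apply: ub_le_sup => //; exists b.
have [e e0 Pe] := Ploc (sup A) (introT andP (conj as_ sb)).
have Pas : P a (sup A).
  have [t [tab Pat] lt] := sup_adherent e0 supA.
  have ts : t <= sup A by apply: ub_le_sup => //; exists b.
  move: ts; rewrite le_eqVlt => /predU1P[<- //|ts].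
  have at_ : a <= t by case/andP: tab.
  apply: (Padd a t (sup A) at_ (ltW ts) Pat _).
  have te : sup A - t < e by rewrite ltrBlDr -ltrBlDl.
  have [+ _] := Pe (sup A - t) (introT idP (etrans (subr_gt0 _ _) ts)) te.
  by rewrite subKr.
suff: P a b by apply.
move: sb; rewrite le_eqVlt => /predU1P[<- //|sb].
pose u := Num.min b (sup A + e / 2).
have su : sup A < u by rewrite lt_min sb ltrDl divr_gt0.
have ub : u <= b by rewrite ge_min lexx.
suff : A u by move=> /(ub_le_sup supA.2); rewrite leNgt su.
split; first by rewrite ub andbT (le_trans as_) // ltW.
apply: (Padd a (sup A) u as_ (ltW su) Pas _).
have [||_] := Pe (u - sup A); rewrite ?subr_gt0 //; last by rewrite addrC subrK.
rewrite ltrBlDl (@le_lt_trans _ _ (sup A + e / 2)) ?ge_min ?lexx ?orbT //.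
by rewrite ltrD2l; lra.
Qed.
End MeanValue.

(** * Directional derivatives and the chain rule *)

Section Directional.
Context (R : realType).
Implicit Types E F G : tvsType R.

Lemma cvg_addv E T (H : set_system T) {FH : Filter H} (f g : T -> E) (a b : E) :
  f @ H --> a -> g @ H --> b -> (fun x => f x + g x) @ H --> a + b.
Proof.
exact: (@continuous2_cvg _ _ _ _ _ _ _ _ (fun x y : E => x + y) _ _
  (@add_continuous E (a, b))).
Qed.

Lemma cvg_scalev E T (H : set_system T) {FH : Filter H} (f : T -> R) (g : T -> E)
    (a : R) (b : E) :
  f @ H --> a -> g @ H --> b -> (fun x => f x *: g x) @ H --> a *: b.
Proof.
exact: (@continuous2_cvg _ _ _ _ _ _ _ _ (fun (x : R^o) (y : E) => x *: y) _ _
  (@scale_continuous R E (a, b))).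
Qed.

Lemma cvg_line E (x v : E) :
  (fun h : R => x + h *: v) @ (0 : R)^' --> x.
Proof.
rewrite -[X in _ --> X]addr0 -(scale0r v).
apply: cvg_addv; first exact: cvg_cst.
apply: cvg_scalev; last exact: cvg_cst.
exact: nbhs_dnbhs.
Qed.

Definition dquot E F (f : E -> F) (x v : E) (h : R) :=
  h^-1 *: (f (x + h *: v) - f x).

(** The quotient is an average of the values [df (y + t *: w', w')] for
    [t] between [0] and [h], all of which lie in a convex neighbourhood of
    [df (y, w)] by joint continuity. The point is that the direction [w'] may
    vary: this is what the chain rule needs. *)
Lemma dquot_uniform E F (V : set E) (f : E -> F) (df : E * E -> F) (y w : E)
    (A : set F) :
  open V -> V y -> (forall x v, V x -> dquot f x v @ (0 : R)^' --> df (x, v)) ->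
  {for (y, w), continuous df} -> nbhs (df (y, w)) A ->
  exists (e : R) (N : set E), [/\ 0 < e, nbhs w N &
    forall h w', h != 0 -> `|h| < e -> N w' -> A (dquot f y w' h)].
Proof.
move=> oV Vy fdf cdf /convex_open_nbhs[D [oD Dy DA cD]].
have := cdf D (open_nbhs_nbhs (conj oD Dy)) => -[[Y N0]] /= [nY nN0] YND.
have nYV : nbhs y (Y `&` V) by apply: filterI => //; exact: open_nbhs_nbhs.
have : (fun z : R * E => y + z.1 *: z.2) @ (nbhs (0 : R, w)) --> y.
  rewrite -[X in _ --> X]addr0 -(scale0r w).
  apply: cvg_addv; first exact: cvg_cst.
  by apply: cvg_scalev; [exact: cvg_fst|exact: cvg_snd].
move=> /(_ _ nYV) [[B N1]] /= [[e /= e0 eB] nN1] BN.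
have eB' t : `|t| < e -> B t by move=> te; apply: eB; rewrite /ball /= sub0r normrN.
have inYV t w' : `|t| < e -> N1 w' -> (Y `&` V) (y + t *: w').
  by move=> te Nw'; apply: (BN (t, w')); split => //=; exact: eB'.
exists e, (N0 `&` N1); split => //; first exact: filterI.
move=> h w' h0 he [N0w' N1w']; apply: DA.
have der t : `|t| < e -> (fun h : R =>
    h^-1 *: (f (y + (t + h) *: w') - f (y + t *: w'))) @ (0 : R)^'
    --> df (y + t *: w', w').
  move=> te; have := fdf _ w' (inYV _ _ te N1w').2.
  apply: cvg_trans; apply: near_eq_cvg; near=> k.
  by rewrite /dquot scalerDl addrA.
have Dder t : `|t| < e -> D (df (y + t *: w', w')).
  by move=> te; apply: (YND (_, _)); split => //=; exact: (inYV _ _ te N1w').1.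
(* The mean value lemma runs on [[0, h]] or [[h, 0]]; the quotient is the
   same for both orientations. *)
have [h1|h1] := ltP 0 h.
  have le_ t : 0 <= t <= h -> `|t| < e.
    by move=> /andP[t0 th]; rewrite ger0_norm // (le_lt_trans th) // -(gtr0_norm h1).
  have := @mean_value _ _ D (fun t => f (y + t *: w')) (fun t => df (y + t *: w', w'))
    0 h h1 oD cD.
  rewrite scale0r addr0 subr0; apply => t /le_; [exact: Dder|exact: der].
have h2 : h < 0 by rewrite lt_neqAle h0.
have le_ t : h <= t <= 0 -> `|t| < e.
  move=> /andP[t0 th]; rewrite ler0_norm // (le_lt_trans _ he) //.
  by rewrite ler0_norm // lerN2.
have := @mean_value _ _ D (fun t => f (y + t *: w')) (fun t => df (y + t *: w', w'))
  h 0 h2 oD cD.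
rewrite scale0r addr0 sub0r invrN scaleNr -scalerN opprB.
by apply => t /le_; [exact: Dder|exact: der].
Unshelve. all: by end_near. Qed.

(** One has [f (x + h *: v) = f x + h *: w] where [w] is the difference
    quotient of [f], so the quotient of [g \o f] is that of [g] at [f x] in the
    variable direction [w], which tends to [df (x, v)]. *)
Lemma dquot_comp E F G (V : set F) (f : E -> F) (g : F -> G)
    (df : E * E -> F) (dg : F * F -> G) (x v : E) :
  open V -> V (f x) ->
  (forall y w, V y -> dquot g y w @ (0 : R)^' --> dg (y, w)) ->
  {for (f x, df (x, v)), continuous dg} ->
  dquot f x v @ (0 : R)^' --> df (x, v) ->
  dquot (g \o f) x v @ (0 : R)^' --> dg (f x, df (x, v)).
Proof.
move=> oV Vfx gdg cdg fdf A nA.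
have [e [N [e0 nN HN]]] := dquot_uniform oV Vfx gdg cdg nA.
have := fdf _ nN; rewrite /= => nN'.
suff: \forall h \near (0 : R)^', A (dquot (g \o f) x v h) by [].
near=> h.
have h0 : h != 0 by near: h; exists 1 => /=.
have : A (dquot g (f x) (dquot f x v h) h).
  apply: HN => //; last by near: h.
  near: h; exists e => //= h; rewrite /ball /= sub0r normrN //.
congr (A (_ *: (g _ - _))); rewrite /dquot scalerA divff // scale1r.
by rewrite addrC subrK.
Unshelve. all: by end_near. Qed.

End Directional.

(** * Maps of class C^n *)

Section MBClass.
Context (R : realType).
Implicit Types E F G : tvsType R.

Lemma MB_class_continuous n E F (U : set E) (f : E -> F) :
  MB_class n U f -> forall x, U x -> {for x, continuous f}.
Proof. by case: n => [|n] []. Qed.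

Lemma MB_classS n E F (U : set E) (f : E -> F) :
  MB_class n.+1 U f -> MB_class n U f.
Proof.
elim: n => [|n IH] in E U f *; first by case.
by move=> [cf [df [fdf /IH Cdf]]]; split => //; exists df.
Qed.

Lemma MB_class_sub n E F (U V : set E) (f : E -> F) :
  V `<=` U -> MB_class n U f -> MB_class n V f.
Proof.
elim: n => [|n IH] in E U V f *; first by move=> VU [cf _]; split => // x /VU/cf.
move=> VU [cf [df [fdf Cdf]]]; split; first by move=> x /VU/cf.
exists df; split; first by move=> x v /VU; exact: fdf.
by apply: IH Cdf => -[x v] [/= /VU].
Qed.

Lemma MB_class_eq_on n E F (U : set E) (f g : E -> F) :
  open U -> (forall x, U x -> f x = g x) ->
  MB_class n U f -> MB_class n U g.
Proof.
move=> oU fg Cf.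
have near_fg x : U x -> \forall y \near x, f y = g y.
  by move=> Ux; apply: filterS fg _; exact: open_nbhs_nbhs.
have cg x : U x -> {for x, continuous g}.
  move=> Ux; rewrite /prop_for /continuous_at -(fg _ Ux).
  apply: cvg_trans (MB_class_continuous Cf Ux).
  by apply: near_eq_cvg; apply: near_fg.
case: n Cf => [|n] Cf; first by split.
case: Cf => cf [df [fdf Cdf]]; split => //; exists df; split => // x v Ux.
apply: cvg_trans (fdf x v Ux).
apply: near_eq_cvg; have := @cvg_line R E x v _ (near_fg _ Ux).
rewrite -/(nbhs _ _) => near_fgv; near=> h; congr (_ *: (_ - _)); last exact: fg.
by near: h.
Unshelve. all: by end_near.
Qed.

(** The local differentials agree where they overlap because limits in a
    Hausdorff space are unique, so they glue. *)
Lemma MB_class_local n E F (U : set E) (f : E -> F) :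
  hausdorff_space F ->
  (forall x, U x -> exists V : set E, [/\ open V, V x & MB_class n V f]) ->
  MB_class n U f.
Proof.
move=> hF; elim: n => [|n IH] in E U f *.
  move=> loc; split => // x /loc[V [_ Vx Cf]]; exact: MB_class_continuous Cf _ Vx.
move=> loc.
have cf x : U x -> {for x, continuous f}.
  by move=> /loc[V [_ Vx Cf]]; exact: MB_class_continuous Cf _ Vx.
split => //.
pose isd (x v : E) (l : F) := dquot f x v @ (0 : R)^' --> l.
have uniq (x v : E) (l l' : F) : isd x v l -> isd x v l' -> l = l'.
  by apply: cvg_unique => //; exact: fmap_proper_filter.
pose df (p : E * E) := xget 0 [set l | isd p.1 p.2 l].
have dfE (x v : E) (l : F) : isd x v l -> df (x, v) = l.
  by move=> il; apply: xget_unique => // l' il'; exact: uniq il' il.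
exists df; split.
  move=> x v /loc[V [_ Vx [_ [df' [fdf' _]]]]].
  by rewrite (dfE _ _ _ (fdf' x v Vx)); exact: fdf'.
apply: IH => -[x v] [/= /loc[V [oV Vx [_ [df' [fdf' Cdf']]]]] _].
exists (V `*` setT); split => //; first exact: open_setX openT.
apply: MB_class_eq_on Cdf'; first exact: open_setX openT.
by move=> [y w] [/= Vy _]; rewrite (dfE _ _ _ (fdf' y w Vy)).
Qed.

Lemma MB_class_linear n E F (U : set E) (f : E -> F) :
  (forall (a : R) x y, f (a *: x + y) = a *: f x + f y) -> continuous f ->
  MB_class n U f.
Proof.
elim: n => [|n IH] in E F U f *; first by move=> _ cf; split => // x _; exact: cf.
move=> lf cf; split => [x _|]; first exact: cf.
exists (f \o snd); split.
  move=> x v _; apply: (@cvg_trans _ (cst (f v) @ (0 : R)^')); last exact: cvg_cst.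
  apply: near_eq_cvg; exists 1 => //= h _ h0.
  by rewrite [x + _]addrC lf addrK scalerA mulVf // scale1r.
apply: IH => [a x y|x]; first exact: lf.
by apply: continuous_comp; [exact: cvg_snd|exact: cf].
Qed.

Lemma MB_class_pair n E F G (U : set E) (f : E -> F) (g : E -> G) :
  MB_class n U f -> MB_class n U g -> MB_class n U (fun x => (f x, g x)).
Proof.
elim: n => [|n IH] in E U f g *.
  by move=> [cf _] [cg _]; split => // x Ux; apply: cvg_pair; [exact: cf|exact: cg].
move=> [cf [df [fdf Cdf]]] [cg [dg [gdg Cdg]]]; split.
  by move=> x Ux; apply: cvg_pair; [exact: cf|exact: cg].
exists (fun p => (df p, dg p)); split; last exact: IH.
by move=> x v Ux; apply: cvg_pair; [exact: fdf|exact: gdg].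
Qed.

(** By the chain rule the differential of the composite is
    [dg \o (f \o fst, df)], again a composite of maps of one class less. *)
Lemma MB_class_comp n E F G (U : set E) (V : set F) (f : E -> F) (g : F -> G) :
  open U -> open V -> (forall x, U x -> V (f x)) ->
  MB_class n U f -> MB_class n V g -> MB_class n U (g \o f).
Proof.
move=> + + + Cf Cg.
have cgf E' F' G' (U' : set E') (V' : set F') m m' (f' : E' -> F') (g' : F' -> G') :
    (forall x, U' x -> V' (f' x)) -> MB_class m U' f' -> MB_class m' V' g' ->
    forall x, U' x -> {for x, continuous (g' \o f')}.
  move=> UV Cf' Cg' x Ux; apply: continuous_comp.
    exact: MB_class_continuous Cf' _ Ux.
  exact: MB_class_continuous Cg' _ (UV _ Ux).
elim: n => [|n IH] in E F G U V f g Cf Cg *.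
  by move=> oU oV UV; split => //; exact: cgf UV Cf Cg.
move=> oU oV UV; split; first exact: cgf UV Cf Cg.
have /MB_classS Cf' := Cf.
case: Cf => cf [df [fdf Cdf]]; case: Cg => cg [dg [gdg Cdg]].
exists (fun p => dg (f p.1, df p)); split.
  move=> x v Ux.
  apply: (@dquot_comp _ E F G V f g df dg x v oV (UV x Ux)); [exact: gdg| |exact: fdf].
  by apply: (MB_class_continuous Cdg); split => //; exact: UV.
apply: (IH _ _ _ _ (V `*` setT) (fun p => (f p.1, df p)) dg) => //.
- apply: MB_class_pair => //; apply: (IH _ _ _ _ U fst f) => //.
  + by apply: MB_class_linear => // x; exact: cvg_fst.
  + exact: open_setX openT.
  + by move=> ? [].
- exact: open_setX openT.
- exact: open_setX openT.
- by move=> [x v] [/= Ux _]; split => //; exact: UV.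
Qed.

Lemma closed_embedding_cvg (F E : topologicalType) T (H : set_system T)
    {FH : Filter H} (i : F -> E) (f : T -> F) (y : F) :
  injective i -> (forall C, closed C -> closed (i @` C)) ->
  (i \o f) @ H --> i y -> f @ H --> y.
Proof.
move=> inj clo ify A; rewrite nbhsE => -[O [oO Oy] OA].
have : nbhs (i y) (~` (i @` (~` O))).
  apply: open_nbhs_nbhs; split.
    by apply: closed_openC; apply: clo; exact: open_closedC.
  by move=> [z nOz /inj zy]; apply: nOz; rewrite zy.
move=> /ify iH; apply: (@filterS _ H FH _ _ _ iH) => t /= nO; apply: OA.
by apply: contrapT => nOt; apply: nO; exists (f t).
Qed.

(** The difference quotients of [i \o f] lie in the closed set [range i],
    hence so does their limit; pulling it back along [i] gives the differential
    of [f], to which the induction applies. *)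
Lemma MB_class_embedding n E F G (U : set E) (f : E -> F) (i : {linear F -> G}) :
  open U -> injective i -> (forall C, closed C -> closed (i @` C)) ->
  MB_class n U (i \o f) -> MB_class n U f.
Proof.
move=> + inj clo; elim: n => [|n IH] in E U f *.
  move=> oU [cif _]; split => // x Ux; apply: (closed_embedding_cvg inj clo).
  exact: cif.
move=> oU [cif [dif [difd Cdif]]]; split.
  by move=> x Ux; apply: (closed_embedding_cvg inj clo); exact: cif.
have quot x v h : i (dquot f x v h) = dquot (i \o f) x v h.
  by rewrite /dquot linearZ_LR linearB.
have range_dif p : (U `*` setT) p -> exists l, i l = dif p.
  move: p => [x v] [/= Ux _].
  suff : (i @` setT) (dif (x, v)) by move=> [l _ <-]; exists l.
  have := difd x v Ux.
  apply: (@closed_cvg _ _ (0 : R)^' _ _ (i @` setT)) => //.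
    exact: clo closedT.
  apply: nearW => h; rewrite -/(dquot (i \o f) x v h) -quot.
  by exists (dquot f x v h).
pose df p := xget 0 [set l | i l = dif p].
have dfE p : (U `*` setT) p -> i (df p) = dif p.
  by move=> /range_dif[l il]; rewrite /df; case: xgetP => // /(_ l).
exists df; split.
  move=> x v Ux; apply: (closed_embedding_cvg inj clo); rewrite dfE //.
  apply: cvg_trans (difd x v Ux); apply: near_eq_cvg; apply: nearW => h /=.
  by rewrite -/(dquot f x v h) quot.
apply: IH; first exact: open_setX openT.
apply: MB_class_eq_on Cdif; first exact: open_setX openT.
by move=> p Up; rewrite /= dfE.
Qed.

End MBClass.

(** * Smooth maps in admissible charts *)

Section MBSmooth.
Context (R : realType).
Implicit Types E F G : tvsType R.

Lemma MB_smooth_sub E F (U V : set E) (f : E -> F) :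
  V `<=` U -> MB_smooth U f -> MB_smooth V f.
Proof. by move=> VU Sf n; exact: MB_class_sub VU (Sf n). Qed.

Lemma MB_smooth_eq_on E F (U : set E) (f g : E -> F) :
  open U -> (forall x, U x -> f x = g x) -> MB_smooth U f -> MB_smooth U g.
Proof. by move=> oU fg Sf n; exact: MB_class_eq_on oU fg (Sf n). Qed.

Lemma MB_smooth_local E F (U : set E) (f : E -> F) :
  hausdorff_space F ->
  (forall x, U x -> exists V : set E, [/\ open V, V x & MB_smooth V f]) ->
  MB_smooth U f.
Proof.
move=> hF loc n; apply: MB_class_local => // x /loc[V [oV Vx Sf]].
by exists V; split.
Qed.

Lemma MB_smooth_linear E F (U : set E) (f : E -> F) :
  (forall (a : R) x y, f (a *: x + y) = a *: f x + f y) -> continuous f ->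
  MB_smooth U f.
Proof. by move=> lf cf n; exact: MB_class_linear. Qed.

Lemma MB_smooth_pair E F G (U : set E) (f : E -> F) (g : E -> G) :
  MB_smooth U f -> MB_smooth U g -> MB_smooth U (fun x => (f x, g x)).
Proof. by move=> Sf Sg n; exact: MB_class_pair. Qed.

Lemma MB_smooth_comp E F G (U : set E) (V : set F) (f : E -> F) (g : F -> G) :
  open U -> open V -> (forall x, U x -> V (f x)) ->
  MB_smooth U f -> MB_smooth V g -> MB_smooth U (g \o f).
Proof. by move=> oU oV UV Sf Sg n; exact: MB_class_comp oU oV UV (Sf n) (Sg n). Qed.

Lemma MB_smooth_embedding E F G (U : set E) (f : E -> F) (i : {linear F -> G}) :
  open U -> injective i -> (forall C, closed C -> closed (i @` C)) ->
  MB_smooth U (i \o f) -> MB_smooth U f.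
Proof. by move=> oU inj clo Sf n; exact: MB_class_embedding oU inj clo (Sf n). Qed.

End MBSmooth.

Section Charts.
Context (R : realType).
Implicit Types T : topologicalType.

Lemma openI_preimage T (T' : topologicalType) (D : set T) (O : set T')
    (f : T -> T') :
  open D -> (forall x, D x -> {for x, continuous f}) -> open O ->
  open (D `&` f @^-1` O).
Proof.
move=> oD cf oO; rewrite openE => x [Dx Ofx].
apply: filterI; first exact: open_nbhs_nbhs.
by apply: (cf x Dx); exact: open_nbhs_nbhs.
Qed.

Lemma chart_img_openI T (E : tvsType R) (c : chart T E) (O : set T) :
  open O -> open (c @` (chart_dom c `&` O)).
Proof.
move=> oO; rewrite (_ : _ @` _ = c @` chart_dom c `&` chart_inv c @^-1` O).
  apply: openI_preimage oO; first exact: chart_img_open.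
  exact: chart_inv_continuous.
apply/seteqP; split=> [_ [x [dx Ox] <-]|_ [[x dx <-]]] /=.
  by split; [exists x|rewrite chart_mapK].
by rewrite chart_mapK // => Ox; exists x.
Qed.

Definition covered T (A : atlas R T) :=
  forall x : T, exists (E : tvsType R) (c : chart T E), A E c /\ chart_dom c x.

Lemma manifold_covered T (A : atlas R T) : is_manifold A -> covered A.
Proof. by case. Qed.

Lemma manifold_admissible T (A : atlas R T) (E : tvsType R) (c : chart T E) :
  is_manifold A -> A E c -> admissible A c.
Proof. by move=> [_ _ AA] Ac F d Ad; exact: AA. Qed.

(** Near each point, insert charts [e] and [e'] of the two atlases:
    [c' \o f \o c^-1 = (c' \o e'^-1) \o (e' \o f \o e^-1) \o (e \o c^-1)],
    and use the chain rule. *)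
Lemma smooth_on_admissible T (T' : topologicalType) (A : atlas R T) (A' : atlas R T')
    (D : set T) (f : T -> T') (E E' : tvsType R) (c : chart T E) (c' : chart T' E') :
  covered A -> covered A' -> open D -> smooth_on A A' D f ->
  admissible A c -> admissible A' c' ->
  MB_smooth (c @` (chart_dom c `&` D `&` f @^-1` chart_dom c'))
    (c' \o f \o chart_inv c).
Proof.
move=> covA covA' oD [cf Sf] adc adc'.
apply: MB_smooth_local; first exact: chart_model_hausdorff c'.
move=> _ [x [[dx Dx] /= dfx] <-].
have [F [e [Ae ex]]] := covA x.
have [F' [e' [Ae' ex']]] := covA' (f x).
pose O := chart_dom e' `&` chart_dom c'.
have oO : open O by apply: openI; exact: chart_dom_open.
have oDO : open (D `&` f @^-1` O) by exact: openI_preimage.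
pose W := chart_dom e `&` (D `&` f @^-1` O).
have oW : open W by apply: openI => //; exact: chart_dom_open.
exists (c @` (chart_dom c `&` W)); split.
- exact: chart_img_openI.
- by exists x => //; split => //; split => //.
have S1 : MB_smooth (c @` (chart_dom c `&` W)) (e \o chart_inv c).
  by apply: MB_smooth_sub (adc _ _ Ae).1 => _ [y [dy [ey _]] <-]; exists y.
have S2 : MB_smooth (e @` (chart_dom e `&` (D `&` f @^-1` O)))
    (e' \o f \o chart_inv e).
  apply: MB_smooth_sub (Sf _ _ _ _ Ae Ae') => _ [y [ey [Dy [fy _]]] <-].
  by exists y.
have S3 := (adc' _ _ Ae').2.
have oV3 : open (e' @` (chart_dom c' `&` chart_dom e')).
  by rewrite setIC; apply: chart_img_openI; exact: chart_dom_open.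
have S12 : MB_smooth (c @` (chart_dom c `&` W))
    ((e' \o f \o chart_inv e) \o (e \o chart_inv c)).
  apply: (MB_smooth_comp _ _ _ S1 S2); [exact: chart_img_openI|exact: chart_img_openI|].
  by move=> _ [y [dy Wy] <-]; exists y; [|rewrite /= chart_mapK].
have S : MB_smooth (c @` (chart_dom c `&` W))
    ((c' \o chart_inv e') \o ((e' \o f \o chart_inv e) \o (e \o chart_inv c))).
  apply: (MB_smooth_comp _ _ _ S12 S3) => //; first exact: chart_img_openI.
  move=> _ [y [dy [ey [Dy [/= e'y c'y]]]] <-]; exists (f y) => //.
  by rewrite /= !chart_mapK.
apply: MB_smooth_eq_on S; first exact: chart_img_openI.
by move=> _ [y [dy [ey [Dy [/= e'y c'y]]]] <-] /=; rewrite !chart_mapK.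
Qed.

(** This is the smoothness of the identity map read in the two charts. *)
Lemma admissible_compatible T (A : atlas R T) (E F : tvsType R) (c : chart T E)
    (d : chart T F) :
  is_manifold A -> admissible A c -> admissible A d -> compatible c d.
Proof.
move=> mA.
have cA := manifold_covered mA.
have Sid : smooth_on A A setT id.
  split; first by move=> x _; exact: cvg_id.
  by move=> E1 E2 c1 c2 A1 A2; rewrite setIT; have [_ _ /(_ _ _ _ _ A1 A2)[]] := mA.
have half E' F' (c' : chart T E') (d' : chart T F') :
    admissible A c' -> admissible A d' ->
    MB_smooth (c' @` (chart_dom c' `&` chart_dom d')) (d' \o chart_inv c').
  move=> ac' ad'.
  by have := smooth_on_admissible cA cA openT Sid ac' ad'; rewrite setIT.
by move=> ac ad; split; [exact: half|rewrite setIC; exact: half].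
Qed.

(** The chart is [c \o f^-1]; both transition conditions are instances of
    the smoothness of [f] and of its inverse in admissible charts. *)
Lemma transport_chart T (T' : topologicalType) (A : atlas R T) (A' : atlas R T')
    (D : set T) (f : T -> T') (E : tvsType R) (c : chart T E) :
  is_manifold A -> is_manifold A' -> open_diffeo_on A A' D f -> admissible A c ->
  exists d : chart T' E, [/\ admissible A' d, chart_dom d = f @` (chart_dom c `&` D)
    & forall x, chart_dom c x -> D x -> d (f x) = c x].
Proof.
move=> mA mA' [oD oI Sf [g [gK Sg]]] ac.
have E1 : f @` (chart_dom c `&` D) = f @` D `&` g @^-1` chart_dom c.
  apply/seteqP; split=> [_ [x [cx Dx] <-]|_ [[x Dx <-]]] /=.
    by split; [exists x|rewrite gK].
  by rewrite gK // => cx; exists x.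
have E2 : (c \o g) @` (f @` (chart_dom c `&` D)) = c @` (chart_dom c `&` D).
  apply/seteqP; split=> [_ [_ [x [cx Dx] <-] <-]|_ [x [cx Dx] <-]] /=.
    by exists x => //; rewrite gK.
  by exists (f x); [exists x|rewrite /= gK].
have od : open (f @` (chart_dom c `&` D)).
  rewrite E1; apply: openI_preimage (chart_dom_open c) => //.
  by case: Sg.
have oi : open ((c \o g) @` (f @` (chart_dom c `&` D))).
  by rewrite E2; exact: chart_img_openI.
have K y : (f @` (chart_dom c `&` D)) y -> (f \o chart_inv c) ((c \o g) y) = y.
  by move=> [x [cx Dx] <-]; rewrite /= gK // chart_mapK.
have cd y : (f @` (chart_dom c `&` D)) y -> {for y, continuous (c \o g)}.
  move=> [x [cx Dx] <-]; apply: continuous_comp; first by apply: Sg.1; exists x.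
  by apply: chart_map_continuous; rewrite gK.
have ci z : ((c \o g) @` (f @` (chart_dom c `&` D))) z ->
    {for z, continuous (f \o chart_inv c)}.
  rewrite E2 => -[x [cx Dx] <-]; apply: continuous_comp.
    by apply: chart_inv_continuous; exists x.
  by rewrite chart_mapK //; apply: Sf.1.
exists (Chart (chart_model_hausdorff c) od oi K cd ci); split => //; last first.
  by move=> x cx Dx /=; rewrite gK.
have [cA cA'] := (manifold_covered mA, manifold_covered mA').
move=> F d Ad; have ad := manifold_admissible mA' Ad; split => /=.
  have := smooth_on_admissible cA cA' oD Sf ac ad.
  apply: MB_smooth_sub => _ [_ [[x [cx Dx] <-] dfx] <-].
  by exists x => //=; rewrite gK.
have := smooth_on_admissible cA' cA oI Sg ad ac.
apply: MB_smooth_sub => _ [_ [[x [cx Dx] <-] dfx] <-].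
exists (f x) => //; split; last by rewrite /= gK.
by split => //; exists x.
Qed.

Lemma prod_chart_admissible T (T' : topologicalType) (A : atlas R T)
    (A' : atlas R T')
    (E E' : tvsType R) (c : chart T E) (c' : chart T' E') :
  admissible A c -> admissible A' c' ->
  admissible (prod_atlas A A') (prod_chart c c').
Proof.
have half (F F' G G' : tvsType R) (c1 : chart T F) (c1' : chart T' F')
    (d : chart T G) (d' : chart T' G') :
    MB_smooth (c1 @` (chart_dom c1 `&` chart_dom d)) (d \o chart_inv c1) ->
    MB_smooth (c1' @` (chart_dom c1' `&` chart_dom d')) (d' \o chart_inv c1') ->
    MB_smooth (prod_chart c1 c1' @`
        (chart_dom (prod_chart c1 c1') `&` chart_dom (prod_chart d d')))
      (prod_chart d d' \o chart_inv (prod_chart c1 c1')).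
  move=> S S'.
  have oU := chart_img_openI (prod_chart c1 c1') (chart_dom_open (prod_chart d d')).
  apply: (@MB_smooth_pair _ _ _ _ _ ((d \o chart_inv c1) \o fst)
    ((d' \o chart_inv c1') \o snd)).
    apply: (MB_smooth_comp oU _ _ _ S).
    - by apply: chart_img_openI; exact: chart_dom_open.
    - by move=> _ [[x x'] [/= [cx cx'] [dx dx']] <-]; exists x.
    - by apply: MB_smooth_linear => // x; exact: cvg_fst.
  apply: (MB_smooth_comp oU _ _ _ S').
  - by apply: chart_img_openI; exact: chart_dom_open.
  - by move=> _ [[x x'] [/= [cx cx'] [dx dx']] <-]; exists x'.
  - by apply: MB_smooth_linear => // x; exact: cvg_snd.
move=> ac ac' _ _ [F F' d d' Ad Ad'].
have [S1 S2] := ac _ _ Ad; have [S1' S2'] := ac' _ _ Ad'.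
split; first exact: half.
rewrite setIC; apply: half; rewrite setIC //.
Qed.

Lemma hausdorff_prod T (T' : topologicalType) :
  hausdorff_space T -> hausdorff_space T' -> hausdorff_space (T * T')%type.
Proof.
move=> hT hT' [x x'] [y y'] cl; congr pair.
  apply: hT => U V xU yV; have [||[z z'] [[/= Uz _] [/= Vz _]]] :=
    cl (U `*` setT) (V `*` setT); last by exists z.
  - by exists (U, setT) => //; split => //; exact: filterT.
  - by exists (V, setT) => //; split => //; exact: filterT.
apply: hT' => U V xU yV; have [||[z z'] [[/= _ Uz] [/= _ Vz]]] :=
  cl (setT `*` U) (setT `*` V); last by exists z'.
- by exists (setT, U) => //; split => //; exact: filterT.
- by exists (setT, V) => //; split => //; exact: filterT.
Qed.

Lemma prod_atlas_manifold T (T' : topologicalType) (A : atlas R T)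
    (A' : atlas R T') :
  is_manifold A -> is_manifold A' -> is_manifold (prod_atlas A A').
Proof.
move=> mA mA'; have [hT cA AA] := mA; have [hT' cA' AA'] := mA'; split.
- exact: hausdorff_prod.
- move=> [x x']; have [E [c [Ac cx]]] := cA x; have [E' [c' [Ac' cx']]] := cA' x'.
  by exists (E * E')%type, (prod_chart c c'); split => //.
move=> E F c d Ac Ad.
suff ac : admissible (prod_atlas A A') c by exact: ac.
by case: Ac => ? ? ? ? ? ?; apply: prod_chart_admissible; exact: manifold_admissible.
Qed.

End Charts.

(** * Closed linear subspaces as locally convex spaces *)

Section SetVal.
Context (T U : topologicalType) (A : set T).

Lemma set_val_continuous : continuous (set_val : A -> T).
Proof. exact: initial_continuous. Qed.

Lemma cvg_set_val (H : set_system U) {FH : Filter H} (f : U -> A) (a : A) :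
  (set_val \o f) @ H --> set_val a -> f @ H --> a.
Proof.
move=> vf W [_ /= [[O oO <-] Oa OW]].
have iO := vf O (open_nbhs_nbhs (conj oO Oa)).
by apply: (@filterS _ H FH _ _ _ iO) => x /= Ox; exact: OW.
Qed.

End SetVal.

Section LinearSubspace.
Context (R : realType) (E : tvsType R) (F : set E) (hF : submod_closed [in F]).

(** The closed linear subspace [F] as a locally convex space in its own
    right. The closure proof is a parameter because the module structure
    depends on it. *)
Definition lin_subspace of submod_closed [in F] : Type := set_type F.
Local Notation L := (lin_subspace hF).

HB.instance Definition _ := Uniform.copy L (set_type F).
HB.instance Definition _ := SubChoice.copy L (set_type F).
HB.instance Definition _ := GRing.SubChoice_isSubLmodule.Build R E [in F] L hF.

Let add_cont : continuous (fun x : L * L => x.1 + x.2).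
Proof.
move=> x; apply: (@cvg_set_val _ _ F).
by apply: (@cvg_addv R E (L * L)%type (nbhs x) _ (val \o fst) (val \o snd));
  apply: continuous_comp; [exact: cvg_fst|exact: set_val_continuous
                          |exact: cvg_snd|exact: set_val_continuous].
Qed.

Let scale_cont : continuous (fun x : R^o * L => x.1 *: x.2).
Proof.
move=> x; apply: (@cvg_set_val _ _ F).
apply: (@cvg_scalev R E (R^o * L)%type (nbhs x) _ fst (val \o snd)).
  exact: cvg_fst.
by apply: continuous_comp; [exact: cvg_snd|exact: set_val_continuous].
Qed.

Let loc_convex :
  exists2 B : set_system L, (forall b, b \in B -> convex_set b) & basis B.
Proof.
have [B cB [oB bB]] := @locally_convex R E.
exists [set (val : L -> E) @^-1` b | b in B].
  move=> _ /set_mem[b /mem_set/cB cb <-] x y l /set_mem xb /set_mem yb.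
  by apply/mem_set/set_mem/(cb (val x) (val y)); exact: mem_set.
split=> [_ [b /oB ob <-]|x W [_ /= [[O oO <-] Ox OW]]]; first by exists b.
have [b [Bb bx] bO] := bB (val x) O (open_nbhs_nbhs (conj oO Ox)).
exists ((val : L -> E) @^-1` b); first by split => //; exists b.
by move=> y /= by_; apply: OW; exact: bO.
Qed.

HB.instance Definition _ :=
  PreTopologicalNmodule_isTopologicalNmodule.Build L add_cont.
HB.instance Definition _ :=
  TopologicalNmodule_isTopologicalLmodule.Build R L scale_cont.
HB.instance Definition _ := Uniform_isTvs.Build R L loc_convex.

Lemma lin_subspace_embedding : closed F ->
  exists (L0 : tvsType R) (i : {linear L0 -> E}),
    [/\ continuous i, injective i, range i = F
      & forall C, closed C -> closed (i @` C)].
Proof.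
move=> cF; exists L, (val : {linear L -> E}).
have rF : range (val : L -> E) = F.
  apply/seteqP; split=> [_ [x _ <-]|x Fx]; first exact: set_valP.
  by exists (SigSub (mem_set Fx) : L).
split => //; first exact: set_val_continuous.
move=> C /closed_openC[O oO OC].
rewrite (_ : _ @` _ = F `&` ~` O).
  by apply: closedI => //; exact: open_closedC.
apply/seteqP; split=> [_ [x Cx <-]|x [Fx nOx]].
  split; first exact: set_valP.
  by move=> Ox; have : (~` C) x by rewrite -OC.
exists (SigSub (mem_set Fx) : L) => //; apply: contrapT => nC.
by apply: nOx; have : (~` C) (SigSub (mem_set Fx) : L) by []; rewrite -OC.
Qed.

End LinearSubspace.

(** * Submanifolds as manifolds *)

Section SubAtlas.
Context (R : realType).
Implicit Types (T : topologicalType) (E F : tvsType R).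

Lemma continuous_eq_on T (T' : topologicalType) (U : set T) (f g : T -> T') (x : T) :
  open U -> U x -> (forall y, U y -> f y = g y) ->
  {for x, continuous f} -> {for x, continuous g}.
Proof.
move=> oU Ux fg cf; rewrite /prop_for /continuous_at -fg //; apply: cvg_trans cf.
by apply: near_eq_cvg; apply: filterS fg _; exact: open_nbhs_nbhs.
Qed.

Lemma injective_hausdorff T (T' : topologicalType) (f : T -> T') :
  continuous f -> injective f -> hausdorff_space T' -> hausdorff_space T.
Proof.
move=> cf inj hT' x y cl; apply/inj/hT' => A B fA fB.
by have [z [Az Bz]] := cl _ _ (cf _ _ fA) (cf _ _ fB); exists (f z).
Qed.

Lemma set_val_inj T (S : set T) : injective (set_val : S -> T).
Proof. by move=> x y; exact: val_inj. Qed.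

(** A submanifold chart followed by the inverse of a linear closed embedding
    onto its target subspace. Such an embedding is a homeomorphism onto its
    image, which gives both continuity statements. *)
Lemma restrict_chart T E F (S : set T) (c : chart T E) (i : {linear F -> E})
    (s0 : S) :
  continuous i -> injective i -> (forall C, closed C -> closed (i @` C)) ->
  c @` (chart_dom c `&` S) = c @` chart_dom c `&` range i ->
  exists d : chart S F, chart_dom d = set_val @^-1` chart_dom c /\
    forall s, chart_dom d s -> i (d s) = c (set_val s).
Proof.
move=> ci inj clo cS.
pose dom : set S := set_val @^-1` chart_dom c.
(* Outside [dom] and its image both maps take junk values. *)
pose fwd (s : S) := xget (0 : F) [set y | i y = c (set_val s)].
pose bwd (y : F) := xget s0 [set s | dom s /\ c (set_val s) = i y].
have fwdE s : dom s -> i (fwd s) = c (set_val s).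
  move=> ds; have : (c @` chart_dom c `&` range i) (c (set_val s)).
    by rewrite -cS; exists (set_val s) => //; split => //; exact: set_valP.
  by move=> [_ [y _ iy]]; rewrite /fwd; case: xgetP => // /(_ y).
have imgE : fwd @` dom = i @^-1` (c @` chart_dom c).
  apply/seteqP; split=> [_ [s ds <-]|y] /=.
    by rewrite fwdE //; exists (set_val s).
  move=> cy; have : (c @` (chart_dom c `&` S)) (i y).
    by rewrite cS; split => //; exists y.
  move=> [x [cx Sx] xy]; exists (SigSub (mem_set Sx)) => //.
  by apply: inj; rewrite fwdE.
have bwdE y : (fwd @` dom) y -> dom (bwd y) /\ c (set_val (bwd y)) = i y.
  move=> [s ds <-]; rewrite /bwd; case: xgetP => [s' -> //|/(_ s)].
  by rewrite fwdE //; case; split.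
have odom : open dom.
  apply: open_comp; last exact: chart_dom_open.
  by move=> s _; exact: set_val_continuous.
have oimg : open (fwd @` dom).
  rewrite imgE; apply: open_comp; last exact: chart_img_open.
  by move=> s _; exact: ci.
have K s : dom s -> bwd (fwd s) = s.
  move=> ds; have [|db cb] := bwdE (fwd s); first by exists s.
  apply: set_val_inj; rewrite -[LHS](chart_mapK db) cb fwdE //; exact: chart_mapK ds.
have cf s : dom s -> {for s, continuous fwd}.
  move=> ds; have cif : {for s, continuous (i \o fwd : S -> E)}.
    apply: (@continuous_eq_on S E dom (c \o set_val) (i \o fwd) s odom ds).
      by move=> y dy /=; rewrite fwdE.
    apply: continuous_comp; first exact: set_val_continuous.
    exact: chart_map_continuous.
  exact: (closed_embedding_cvg inj clo cif).
have cb y : (fwd @` dom) y -> {for y, continuous bwd}.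
  move=> dy; apply: cvg_set_val.
  apply: (@continuous_eq_on _ _ _ (chart_inv c \o i) (set_val \o bwd) y oimg dy).
    by move=> z /bwdE[dz cz] /=; rewrite -cz chart_mapK.
  apply: continuous_comp; first exact: ci.
  by apply: chart_inv_continuous; move: dy; rewrite imgE.
have hF : hausdorff_space F := injective_hausdorff ci inj (chart_model_hausdorff c).
by exists (Chart hF odom oimg K cf cb).
Qed.

Lemma sub_atlas_covered T (A : atlas R T) (S : set T) :
  is_submanifold A S -> covered (sub_atlas A (S := S)).
Proof.
move=> subS x; have [E [c [F [ac cx hF cF cS]]]] := subS _ (set_valP x).
have [L [i [ci inj rF clo]]] := lin_subspace_embedding hF cF.
have cSi : c @` (chart_dom c `&` S) = c @` chart_dom c `&` range i by rewrite cS rF.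
have [d [dd id]] := restrict_chart x ci inj clo cSi.
exists L, d; split; last by rewrite dd.
by exists E, c, i; split.
Qed.

(** After composition with the closed embedding [i'] of the target model, a
    transition map is the restriction along [i] of a transition map between
    admissible ambient charts; closed embeddings reflect smoothness. *)
Lemma sub_atlas_compatible T (A : atlas R T) (S : set T) F F'
    (d : chart S F) (d' : chart S F') :
  is_manifold A -> sub_atlas A d -> sub_atlas A d' -> compatible d d'.
Proof.
move=> mA.
have half (G G' : tvsType R) (e : chart S G) (e' : chart S G') :
    sub_atlas A e -> sub_atlas A e' ->
    MB_smooth (e @` (chart_dom e `&` chart_dom e')) (e' \o chart_inv e).
  move=> [E [c [i [ac [ci _ _] _ ed ei]]]] [E' [c' [i' [ac' [_ inj clo] _ ed' ei']]]].
  have oU := chart_img_openI e (chart_dom_open e').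
  apply: (MB_smooth_embedding oU inj clo).
  have [Scc _] := admissible_compatible mA ac ac'.
  have := @MB_smooth_comp _ _ _ _ (e @` (chart_dom e `&` chart_dom e')) _ i _ oU
    (chart_img_openI c (chart_dom_open c')) _ _ Scc.
  have Si : MB_smooth (e @` (chart_dom e `&` chart_dom e')) i.
    by apply: MB_smooth_linear ci => a x y; rewrite linearD linearZ_LR.
  have iU y : (e @` (chart_dom e `&` chart_dom e')) y ->
      (c @` (chart_dom c `&` chart_dom c')) (i y).
    move=> [s [es es'] <-]; exists (set_val s); last by rewrite ei.
    by split; [move: es; rewrite ed|move: es'; rewrite ed'].
  move=> /(_ iU Si); apply: MB_smooth_eq_on => // _ [s [es es'] <-] /=.
  rewrite ei // chart_mapK //; last by move: es; rewrite ed.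
  by rewrite (chart_mapK es) ei'.
by move=> Ad Ad'; split; [exact: half|rewrite setIC; exact: half].
Qed.

Lemma sub_atlas_manifold T (A : atlas R T) (S : set T) :
  is_manifold A -> is_submanifold A S -> is_manifold (sub_atlas A (S := S)).
Proof.
move=> mA subS; split.
- apply: (@injective_hausdorff _ _ set_val); [exact: set_val_continuous|exact: set_val_inj|].
  by case: mA.
- exact: sub_atlas_covered.
- by move=> F F' d d'; exact: sub_atlas_compatible.
Qed.

(** [S] is relatively closed in each of its chart domains, hence in their
    union. *)
Lemma submanifold_locally_closed T (A : atlas R T) (S : set T) :
  is_submanifold A S -> locally_closed S.
Proof.
move=> subS.
exists (\bigcup_(O in [set O | open O /\
    exists C, closed C /\ S `&` O = O `&` C]) O), (closure S).
split; [by apply: bigcup_open => O []|exact: closed_closure|].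
apply/seteqP; split=> [x Sx|x [[O [oO [C [cC SC]]] Ox] clS]].
  split; last exact: subset_closure.
  have [E [c [F [ac cx _ cF cS]]]] := subS _ Sx.
  exists (chart_dom c) => //; split; first exact: chart_dom_open.
  exists (~` (chart_dom c `&` c @^-1` (~` F))); split.
    apply: open_closedC; apply: openI_preimage; first exact: chart_dom_open.
      exact: chart_map_continuous.
    exact: closed_openC.
  apply/seteqP; split=> [y [Sy cy]|y [cy nF]]; split => //.
    move=> [_]; apply => //.
    have : (c @` chart_dom c `&` F) (c y) by rewrite -cS; exists y.
    by case.
  have Fy : F (c y) by apply: contrapT => nFy; apply: nF.
  have : (c @` (chart_dom c `&` S)) (c y) by rewrite cS; split => //; exists y.
  by move=> [z [cz Sz] zy]; rewrite -(chart_mapK cy) -zy chart_mapK.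
suff : (S `&` O) x by case.
rewrite SC; split => //; apply: contrapT => nCx.
have : nbhs x (O `&` ~` C).
  by apply: open_nbhs_nbhs; split => //; apply: openI => //; exact: closed_openC.
move=> /clS[y [Sy [Oy nCy]]]; apply: nCy.
by have : (S `&` O) y by []; rewrite SC => -[].
Qed.

End SubAtlas.

(** * Orbit types and slices *)

Section OrbitTypes.
Local Open Scope group_scope.

Lemma conjugate_mem (G : groupType) (a : G) (H : set G) (g : G) :
  conjugate a H g <-> H (a^-1 * g * a).
Proof.
split=> [[h Hh <-]|Hg]; first by rewrite !mulgA mulVg mul1g mulgVK.
by exists (a^-1 * g * a) => //; rewrite !mulgA mulgV mul1g mulgK.
Qed.

Lemma conjugateM (G : groupType) (a b : G) (H : set G) :
  conjugate a (conjugate b H) = conjugate (a * b) H.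
Proof.
by apply/seteqP; split=> g; rewrite !conjugate_mem invgM !mulgA.
Qed.

Lemma conjugate1 (G : groupType) (H : set G) : conjugate 1 H = H.
Proof. by apply/seteqP; split=> g; rewrite conjugate_mem invg1 mul1g mulg1. Qed.

Lemma conj_class_eqP (G : groupType) (H K : set G) :
  conj_class H K <-> conj_class K = conj_class H.
Proof.
split=> [[a _ <-]|<-]; last by exists 1 => //; exact: conjugate1.
apply/seteqP; split=> _ [b _ <-]; first by exists (b * a) => //; rewrite conjugateM.
by exists (b * a^-1) => //; rewrite conjugateM mulgVK.
Qed.

Lemma stabilizer_act (G : groupType) (M : Type) (act : G -> M -> M) (a : G)
    (m : M) :
  is_action act -> stabilizer act (act a m) = conjugate a (stabilizer act m).
Proof.
move=> [act1 actM]; apply/seteqP; split=> g; rewrite conjugate_mem /stabilizer /= !actM.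
  by move=> ->; rewrite -actM mulVg act1.
by move=> /(congr1 (act a)); rewrite -actM mulgV act1.
Qed.

Lemma orbit_type_act (G : groupType) (M : Type) (act : G -> M -> M) (a : G)
    (m : M) :
  is_action act -> orbit_type act (act a m) = orbit_type act m.
Proof.
move=> aG; apply/conj_class_eqP; rewrite stabilizer_act //.
by exists a.
Qed.

Lemma subconjugate_orbit_type (G : groupType) (M : Type) (act : G -> M -> M)
    (H : set G) (m m' : M) :
  orbit_type act m = orbit_type act m' ->
  subconjugate H (stabilizer act m) -> subconjugate H (stabilizer act m').
Proof.
move=> /esym/conj_class_eqP[b _ <-] [a aH]; exists (b * a); rewrite -conjugateM.
by move=> _ [g /aH Hg <-]; exists g.
Qed.

End OrbitTypes.

Section Slices.
Context (R : realType) (G : preTopologicalGroupType) (M : topologicalType)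
  (AG : atlas R G) (AM : atlas R M) (act : G -> M -> M).
Hypotheses (mM : is_manifold AM) (aG : is_action act).

(** Every point of the tube is [a . s] with [s] in the slice, and an element
    fixing [s] makes [S] meet its translate, so it fixes [m]. *)
Lemma slice_subconjugate_nbhs (m : M) (S : set M) : is_slice AG AM act m S ->
  \forall x \near m, subconjugate (stabilizer act x) (stabilizer act m).
Proof.
move=> [_ [_ SL2 [_ [AQ [_ [U [chi /= [_ _ _ [_ oW _ _] Wm]]]]]] _]].
apply: filterS (open_nbhs_nbhs (conj oW Wm)) => _ [[q s] _ <-] /=.
exists (chi q)^-1%g; rewrite stabilizer_act // conjugateM mulVg conjugate1.
move=> g gs; apply: SL2; exists (set_val s); split; last exact: set_valP.
by exists (set_val s) => //; exact: set_valP.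
Qed.

(** In the slice diffeomorphism [G/G_m x S -> M], the orbit type of the image
    of [(q, s)] is that of [s]; the points of orbit type [(G_m)] are thus the
    image of [G/G_m x S_(G_m)]. A product of a chart of [G/G_m] and a
    submanifold chart of [S_(G_m)] in [S], carried to [M], is the chart. *)
Lemma orbit_type_submanifold_chart (m : M) (S : set M) : is_slice AG AM act m S ->
  exists (E : tvsType R) (c : chart M E) (F : set E),
    [/\ admissible AM c, chart_dom c m, submod_closed [in F], closed F
      & c @` (chart_dom c `&` of_orbit_type act (orbit_type act m)) =
        c @` chart_dom c `&` F].
Proof.
move=> [[subS _] [_ _ [_ [AQ [[mQ _ _] [U [chi /= [_ _ _ dPhi Wm]]]]]] [_ subS']]].
have mS := sub_atlas_manifold mM subS.
have mP := prod_atlas_manifold mQ mS.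
pose Phi (p : coset_space (stabilizer act m) * S) := act (chi p.1) (set_val p.2).
have orbPhi p : of_orbit_type act (orbit_type act m) (Phi p) <->
    conj_class (stabilizer act m) (stabilizer act (set_val p.2)).
  by rewrite /of_orbit_type /= orbit_type_act // conj_class_eqP.
case: Wm => -[q s] [/= Uq _] qsm.
have Ss : conj_class (stabilizer act m) (stabilizer act (set_val s)).
  by apply/(orbPhi (q, s)); rewrite /Phi /= qsm.
have [EQ [cQ [AcQ cQq]]] := manifold_covered mQ q.
have [E [cS [F [acS cSs hF cF cSF]]]] := subS' s Ss.
have ac := prod_chart_admissible (manifold_admissible mQ AcQ) acS.
have [d [ad dd dE]] := transport_chart mP mM dPhi ac.
exists (EQ * E)%type, d, (setT `*` F); split => //.
- by rewrite dd; exists (q, s).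
- split; first by rewrite inE; split => //; apply/set_mem; exact: hF.1.
  move=> a [x1 x2] [y1 y2]; rewrite !inE => -[_ /= Fx] [_ /= Fy]; split => //.
  by apply/set_mem; apply: hF.2; exact: mem_set.
- rewrite (_ : _ `*` _ = snd @^-1` F).
    by apply: preimage_closed => // p _; exact: cvg_snd.
  by apply/seteqP; split=> [p []|p Fp].
have FE s' : chart_dom cS s' -> F (cS s') <->
    conj_class (stabilizer act m) (stabilizer act (set_val s')).
  move=> ds'; split=> [Fs'|Ss'].
    have : (cS @` chart_dom cS `&` F) (cS s') by split => //; exists s'.
    rewrite -cSF => -[z [dz Sz] zs']; rewrite -(chart_mapK ds') -zs' chart_mapK //.
  by have : (cS @` chart_dom cS `&` F) (cS s') by [rewrite -cSF; exists s'|]; case.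
have {}dE q' s' : chart_dom cQ q' -> chart_dom cS s' -> U q' ->
    d (act (chi q') (set_val s')) = (cQ q', cS s').
  by move=> dq ds Uq'; rewrite (dE (q', s')).
rewrite dd; apply/seteqP; split=> [_ [_ [[[q' s'] [[/= dq ds] [Uq' _]] <-] X] <-]|].
  split; first by exists (Phi (q', s')) => //; exists (q', s').
  by rewrite dE //; split => //=; apply/FE => //; apply/(orbPhi (q', s')).
move=> _ [[_ [[q' s'] [[/= dq ds] [Uq' _]] <-] <-]]; rewrite dE // => -[_ /= Fs'].
exists (Phi (q', s')); last by rewrite -dE.
split; first by exists (q', s').
by apply/orbPhi/FE.
Qed.

End Slices.

(** The frontier [closure Y \ Y] of a locally closed set is closed, so it
    contains [closure X] as soon as it contains [X]. *)
Lemma frontier_condition (T : topologicalType) (X Y : set T) :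
  locally_closed Y -> X `<=` closure Y `\` Y -> Y `&` closure X = set0.
Proof.
move=> [O [C [oO cC YE]]] XY; apply/seteqP; split=> // y [Yy clX].
have [|z [Xz Oz]] := clX O.
  by apply: open_nbhs_nbhs; split => //; move: Yy; rewrite YE => -[].
(* [z] is close to [Y] and lies in the open part of a presentation of [Y] as
   a locally closed set, so it belongs to [Y]. *)
have [clY nY] := XY z Xz; apply: nY; rewrite YE; split => //.
rewrite -[C](_ : closure C = C); last by apply/esym/closure_id.
by apply: closureS clY; rewrite YE; exact: subIsetr.
Qed.

(** * The stratification *)

Theorem theorem4p2 (R : realType) (G : preTopologicalGroupType)
  (M : topologicalType) (AG : atlas R G) (AM : atlas R M) (act : G -> M -> M)
  (lieG : is_lie_group AG)
  (GM : is_Gmanifold AG AM act)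
  (proper_act : is_proper_action act)
  (slices : forall m : M, exists S : set M, is_slice AG AM act m S)
  (approximation : forall H : set G, range (stabilizer act) H ->
     orbit_type_ge act H `<=` closure (of_orbit_type act (conj_class H))) :
  (forall H : set G, range (stabilizer act) H ->
     is_submanifold AM (of_orbit_type act (conj_class H))) /\
  is_stratification (range (orbit_type act))
    (fun t => sub_atlas AM (S := of_orbit_type act t)).
Proof.
have [mM aG _] := GM.
have subX t : is_submanifold AM (of_orbit_type act t).
  move=> m <-; have [S slS] := slices m.
  exact: (orbit_type_submanifold_chart mM aG slS).
split=> [H _|]; first exact: subX.
split.
- by case: mM.
- split.
  + by apply/seteqP; split=> // m _; exists (orbit_type act m) => //; exists m.
  + by move=> i j _ _ [m [<- <-]].
  + by move=> _ [m _ <-]; exists m.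
- move=> t _; split; first exact: submanifold_locally_closed (subX t).
  exact: sub_atlas_manifold.
move=> i j _ _ ij [m [mi mj]].
suff incl : of_orbit_type act i `<=`
    closure (of_orbit_type act j) `\` of_orbit_type act j.
  split => //; apply: frontier_condition incl.
  exact: submanifold_locally_closed (subX j).
have [S slS] := slices m.
(* The tube around [m] meets the stratum [j] in a point [x] whose stabilizer is
   subconjugate to that of [m]; the approximation property then applies at every
   point of the stratum [i]. *)
have [x [xj xm]] := mj _ (slice_subconjugate_nbhs aG slS).
move=> m' m'i; split; last by move=> m'j; have : set0 m' by rewrite -ij.
rewrite -xj; apply: approximation; first by exists x.
by apply: subconjugate_orbit_type xm; rewrite m'i.
Qed.
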